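(* Assume $A_n$ satisfies (C1) and the mean field condition $\lim_{n\to\infty}\frac1n\sum_{i,j=1}^nA_n(i,j)^2=0$, and fix $(\beta,B)\in\Theta$. Let $\mathbf X\sim\mathbb P_{n,\beta,B}$. Then: (a) $f_n(b(\mathbf X))-I(b(\mathbf X))-r_n=o_p(n)$, i.e. $\frac1n\big(f_n(b(\mathbf X))-I(b(\mathbf X))-r_n\big)\to0$ in probability, where $r_n=\sup_{\mathbf y\in[-1,1]^n}\{f_n(\mathbf y)-I(\mathbf y)\}$; (b) $\|\nabla f_n(b(\mathbf X))-\nabla I(b(\mathbf X))\|=o_p(\sqrt n)$, i.e. $\frac{1}{\sqrt n}\|\nabla f_n(b(\mathbf X))-\nabla I(b(\mathbf X))\|\to0$ in probability.
   Context: For each $n$, $A_n$ is a known symmetric $n\times n$ matrix with non-negative entries and zero diagonal. The Ising model is $\mathbb P_{n,\beta,B}(\mathbf X=\mathbf x)=Z_n(\beta,B)^{-1}\exp(\frac{\beta}{2}\mathbf x^\top A_n\mathbf x+B\sum_i x_i)$ on $\{-1,1\}^n$. (C1): there is a constant $\gamma<\infty$ with $\max_{i}\sum_{j}A_n(i,j)\le\gamma$ for all $n$. $\Theta=\{(\beta,B):\beta>0,B\ne0\}$. For $\mathbf y\in[-1,1]^n$: $m_i(\mathbf y)=\sum_jA_n(i,j)y_j$, $b_i(\mathbf y)=\tanh(\beta m_i(\mathbf y)+B)$, $b(\mathbf y)=(b_1(\mathbf y),\dots,b_n(\mathbf y))$, $f_n(\mathbf y)=\frac\beta2\mathbf y^\top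 A_n\mathbf y+B\sum_iy_i$, and $I(\mathbf y)=\sum_{i=1}^n\big\{\frac{1+y_i}{2}\log\frac{1+y_i}{2}+\frac{1-y_i}{2}\log\frac{1-y_i}{2}\big\}$ (with $0\log0=0$); $\nabla$ is the gradient in $\mathbf y$ (so $\nabla f_n(\mathbf y)-\nabla I(\mathbf y)=\beta A_n\mathbf y+B\mathbf 1-\operatorname{arctanh}(\mathbf y)$ componentwise, for $\mathbf y\in(-1,1)^n$). *)

(* Defs.v *)
From Stdlib Require Import Reals List.
Import ListNotations.
Open Scope R_scope.

(* Matrices: A n i j is the (i,j) entry of A_n, indices 0..n-1 (0-based).
   Vectors in R^n: functions nat -> R, only indices < n matter. *)

Fixpoint rsum (n : nat) (f : nat -> R) : R :=
  match n with O => 0 | S k => rsum k f + f k end.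

Definition symmetric_nonneg_zero_diag (A : nat -> nat -> nat -> R) : Prop :=
  forall n, (forall i j, (i < n)%nat -> (j < n)%nat -> A n i j = A n j i /\ 0 <= A n i j)
         /\ (forall i, (i < n)%nat -> A n i i = 0).

Definition cond_C1 (A : nat -> nat -> nat -> R) : Prop :=
  exists gamma : R, forall n i, (i < n)%nat -> rsum n (fun j => A n i j) <= gamma.

Definition mean_field (A : nat -> nat -> nat -> R) : Prop :=
  Un_cv (fun n => / INR n * rsum n (fun i => rsum n (fun j => (A n i j) ^ 2))) 0.

(* all configurations x in {-1,1}^n (as functions, zero outside [0,n)) *)
Fixpoint configs (n : nat) : list (nat -> R) :=
  match n with
  | O => [fun _ => 0]
  | S k => flat_map (fun x => [fun i => if Nat.eqb i k then 1 else x i;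
                                 fun i => if Nat.eqb i k then -1 else x i]) (configs k)
  end.

Definition quad (A : nat -> nat -> nat -> R) (n : nat) (y : nat -> R) : R :=
  rsum n (fun i => rsum n (fun j => y i * A n i j * y j)).

Definition f_n (A : nat -> nat -> nat -> R) (beta B : R) (n : nat) (y : nat -> R) : R :=
  beta / 2 * quad A n y + B * rsum n y.

Definition weight A beta B n (x : nat -> R) : R := exp (f_n A beta B n x).
Definition Z A beta B n : R := fold_right Rplus 0 (map (weight A beta B n) (configs n)).

Definition prob_abs_gt A beta B n (Y : (nat -> R) -> R) (eps : R) : R :=
  fold_right Rplus 0
    (map (fun x => if Rlt_dec eps (Rabs (Y x)) then weight A beta B n x else 0) (configs n))
  / Z A beta B n.

Definition conv_prob_zero A beta B (Y : nat -> (nat -> R) -> R) : Prop :=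
  forall eps, 0 < eps -> Un_cv (fun n => prob_abs_gt A beta B n (Y n) eps) 0.

Definition m_i A n (y : nat -> R) (i : nat) : R := rsum n (fun j => A n i j * y j).
Definition b_vec A beta B n (y : nat -> R) : nat -> R :=
  fun i => tanh (beta * m_i A n y i + B).

Definition xlnx (t : R) : R := if Req_dec_T t 0 then 0 else t * ln t.

Definition I_n (n : nat) (y : nat -> R) : R :=
  rsum n (fun i => xlnx ((1 + y i) / 2) + xlnx ((1 - y i) / 2)).

Definition artanh (t : R) : R := / 2 * ln ((1 + t) / (1 - t)).

(* Euclidean norm of grad f_n(y) - grad I(y) = beta A_n y + B 1 - artanh(y) *)
Definition grad_norm A beta B n (y : nat -> R) : R :=
  sqrt (rsum n (fun i => (beta * m_i A n y i + B - artanh (y i)) ^ 2)).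

Definition FI_values A beta B n (v : R) : Prop :=
  exists y : nat -> R, (forall i, (i < n)%nat -> -1 <= y i <= 1) /\
                       v = f_n A beta B n y - I_n n y.

(* Main.v *)
(** Write [D x = x - b x]. Since [x_j - b_j(x)] has conditional mean zero given the other spins and
    [b_k] changes by at most [beta A_kj] when spin [j] is erased, [E |A D(X)|^2 = O(sum A_ij^2)],
    which is [o(n)]. As [artanh (b_i x) = beta m_i x + B], the gradient at [b x] is [-beta A D(x)],
    so this is part (b).

    For part (a), let [F = f_n - I]. A maximal orthonormal family of vectors which [A] does not
    contract has [o(n)] members, so rounding the coordinates of [x] along it splits the
    configurations into [exp (o(n))] cells, up to summable weights, on each of which [A x] is
    constant up to a small multiple of [sqrt n]. Linearizing the quadratic form around a
    configuration [x0] with [A D(x0)] small, the Gibbs weight on the cell of [x0] is at most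
    [exp (F (b x0) + o(n))] times the product measure of mean [b x0], so the cell has mass at most
    [exp (F (b x0) + o(n))]. With [Z >= exp r_n] (Gibbs variational principle), the
    configurations with [A D(x)] small and [F (b x) < r_n - eps n] have exponentially small
    probability. *)
Require Import Defs.
From Stdlib Require Import Reals List Lra Lia ZArith Classical FunctionalExtensionality.
Open Scope R_scope.

(** * Sums, inner products and matrices *)

Lemma rsum_ext n f g : (forall i, (i < n)%nat -> f i = g i) -> rsum n f = rsum n g.
Proof.
  induction n as [|n IH]; simpl; intros H; [easy|].
  rewrite IH, H; auto.
Qed.

Lemma rsum_le n f g : (forall i, (i < n)%nat -> f i <= g i) -> rsum n f <= rsum n g.
Proof.
  induction n as [|n IH]; simpl; intros H; [lra|].
  apply Rplus_le_compat; auto.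
Qed.

Lemma rsum_plus n f g : rsum n (fun i => f i + g i) = rsum n f + rsum n g.
Proof. induction n as [|n IH]; simpl; [ring|rewrite IH; ring]. Qed.

Lemma rsum_scal n c f : rsum n (fun i => c * f i) = c * rsum n f.
Proof. induction n as [|n IH]; simpl; [ring|rewrite IH; ring]. Qed.

Lemma rsum_const n c : rsum n (fun _ => c) = INR n * c.
Proof. induction n as [|n IH]; [simpl; ring|]. rewrite S_INR; simpl; rewrite IH; ring. Qed.

Lemma rsum_zero n : rsum n (fun _ => 0) = 0.
Proof. rewrite rsum_const; ring. Qed.

Lemma rsum_nonneg n f : (forall i, (i < n)%nat -> 0 <= f i) -> 0 <= rsum n f.
Proof. intros H; rewrite <- (rsum_zero n); now apply rsum_le. Qed.

Lemma rsum_swap n m (f : nat -> nat -> R) :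
  rsum n (fun i => rsum m (fun j => f i j)) = rsum m (fun j => rsum n (fun i => f i j)).
Proof.
  induction n as [|n IH]; simpl; [now rewrite rsum_zero|].
  now rewrite IH, rsum_plus.
Qed.

Lemma rsum_pick n i f :
  (i < n)%nat -> rsum n (fun j => if Nat.eqb j i then f j else 0) = f i.
Proof.
  induction n as [|n IH]; simpl; intros H; [lia|].
  destruct (Nat.eqb_spec n i) as [->|ne].
  - rewrite (rsum_ext i _ (fun _ => 0)), rsum_zero; [ring|].
    intros j Hj; destruct (Nat.eqb_spec j i); [lia|easy].
  - rewrite IH by lia; ring.
Qed.

Lemma rsum_abs n f : Rabs (rsum n f) <= rsum n (fun i => Rabs (f i)).
Proof.
  induction n as [|n IH]; simpl; [rewrite Rabs_R0; lra|].
  eapply Rle_trans; [apply Rabs_triang|]; lra.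
Qed.

Definition inner n (u v : nat -> R) : R := rsum n (fun i => u i * v i).
Definition normsq n (u : nat -> R) : R := inner n u u.
Definition mv (M : nat -> nat -> R) n (u : nat -> R) (i : nat) : R :=
  rsum n (fun j => M i j * u j).
Definition frob (M : nat -> nat -> R) n : R :=
  rsum n (fun i => rsum n (fun j => M i j ^ 2)).

Lemma inner_ext n u v u' v' :
  (forall i, (i < n)%nat -> u i = u' i) -> (forall i, (i < n)%nat -> v i = v' i) ->
  inner n u v = inner n u' v'.
Proof. intros Hu Hv; apply rsum_ext; intros; rewrite Hu, Hv; auto. Qed.

Lemma inner_sym n u v : inner n u v = inner n v u.
Proof. apply rsum_ext; intros; ring. Qed.

Lemma inner_lin n u v a w b :
  inner n u (fun i => a * v i + b * w i) = a * inner n u v + b * inner n u w.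
Proof.
  unfold inner; rewrite <- !rsum_scal, <- rsum_plus; apply rsum_ext; intros; ring.
Qed.

Lemma normsq_nonneg n u : 0 <= normsq n u.
Proof. apply rsum_nonneg; intros; nra. Qed.

Lemma normsq_lin n u v a b :
  normsq n (fun i => a * u i + b * v i) =
  a * a * normsq n u + 2 * a * b * inner n u v + b * b * normsq n v.
Proof.
  unfold normsq, inner; rewrite <- !rsum_scal, <- !rsum_plus; apply rsum_ext; intros; ring.
Qed.

Lemma normsq_plus_le n u v :
  normsq n (fun i => u i + v i) <= 2 * normsq n u + 2 * normsq n v.
Proof.
  unfold normsq, inner; rewrite <- !rsum_scal, <- rsum_plus; apply rsum_le.
  intros i _; pose proof (Rle_0_sqr (u i - v i)); unfold Rsqr in *; lra.
Qed.

Lemma mv_lin M n u v a b i :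
  mv M n (fun j => a * u j + b * v j) i = a * mv M n u i + b * mv M n v i.
Proof. exact (inner_lin n (M i) u a v b). Qed.

Lemma mv_ext M n u v i : (forall j, (j < n)%nat -> u j = v j) -> mv M n u i = mv M n v i.
Proof. intros H; apply rsum_ext; intros; rewrite H; auto. Qed.

Lemma inner_mv_sym M n u v :
  (forall i j, (i < n)%nat -> (j < n)%nat -> M i j = M j i) ->
  inner n u (mv M n v) = inner n v (mv M n u).
Proof.
  intros Hs; unfold inner, mv.
  transitivity (rsum n (fun i => rsum n (fun j => u i * (M i j * v j)))).
  { apply rsum_ext; intros; now rewrite <- rsum_scal. }
  rewrite rsum_swap; apply rsum_ext; intros i Hi.
  rewrite <- rsum_scal; apply rsum_ext; intros j Hj.
  rewrite (Hs i j); auto; ring.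
Qed.

(** Adding index [n] raises the gap between the two sides by [a n] times the sum of
    [a j * (y n - y j) ^ 2], which is nonnegative. *)
Lemma weighted_cauchy_schwarz n a y :
  (forall j, (j < n)%nat -> 0 <= a j) ->
  rsum n (fun j => a j * y j) ^ 2 <= rsum n a * rsum n (fun j => a j * y j ^ 2).
Proof.
  induction n as [|n IH]; intros Ha; cbn [rsum]; [lra|].
  assert (H1 := IH (fun j Hj => Ha j (Nat.lt_lt_succ_r _ _ Hj))).
  assert (Hn := Ha n (Nat.lt_succ_diag_r n)).
  assert (H3 : 0 <= rsum n (fun j => a j * (y n - y j) ^ 2)).
  { apply rsum_nonneg; intros; apply Rmult_le_pos; [apply Ha; lia|apply pow2_ge_0]. }
  assert (H4 : rsum n (fun j => a j * (y n - y j) ^ 2) =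
    y n ^ 2 * rsum n a + (- 2 * y n) * rsum n (fun j => a j * y j)
    + rsum n (fun j => a j * y j ^ 2)).
  { rewrite <- !rsum_scal, <- !rsum_plus; apply rsum_ext; intros; ring. }
  set (P := rsum n a) in *. set (Q := rsum n (fun j => a j * y j)) in *.
  set (T := rsum n (fun j => a j * y j ^ 2)) in *.
  assert (0 <= a n * (y n ^ 2 * P + -2 * y n * Q + T)) by (apply Rmult_le_pos; lra).
  nra.
Qed.

(** Cauchy-Schwarz with weights [M i j] bounds each squared entry by [g] times a weighted sum of the
    [u j ^ 2]. By symmetry the column sums are at most [g] too, which gives the second factor
    [g]. *)
Lemma schur_test M n g u :
  (forall i j, (i < n)%nat -> (j < n)%nat -> M i j = M j i /\ 0 <= M i j) ->
  (forall i, (i < n)%nat -> rsum n (M i) <= g) -> 0 <= g ->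
  normsq n (mv M n u) <= g ^ 2 * normsq n u.
Proof.
  intros HM Hg Hg0.
  apply Rle_trans with (rsum n (fun i => g * rsum n (fun j => M i j * u j ^ 2))).
  - apply rsum_le; intros i Hi.
    replace (mv M n u i * mv M n u i) with (mv M n u i ^ 2) by ring.
    eapply Rle_trans.
    + apply weighted_cauchy_schwarz; intros; now apply HM.
    + apply Rmult_le_compat_r; [|now apply Hg].
      apply rsum_nonneg; intros; apply Rmult_le_pos; [now apply HM|apply pow2_ge_0].
  - rewrite rsum_scal, rsum_swap.
    replace (g ^ 2 * normsq n u) with (g * (g * normsq n u)) by ring.
    apply Rmult_le_compat_l; [easy|].
    unfold normsq, inner; rewrite <- rsum_scal; apply rsum_le; intros j Hj.
    rewrite (rsum_ext n _ (fun i => u j ^ 2 * M j i)).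
    + rewrite rsum_scal.
      pose proof (Rmult_le_compat_l _ _ _ (pow2_ge_0 (u j)) (Hg j Hj)).
      change (rsum n (fun i => M j i)) with (rsum n (M j)); lra.
    + intros i Hi; rewrite (proj1 (HM i j Hi Hj)); ring.
Qed.

(** Termwise, [t <= t ^ 2 / (2 * c) + c / 2]; after summation each of the two terms contributes at
    most [c / 2 * INR n]. *)
Lemma inner_cube_bound n x d c :
  (forall i, (i < n)%nat -> Rabs (x i) <= 1) -> 0 < c -> normsq n d <= c ^ 2 * INR n ->
  Rabs (inner n x d) <= c * INR n.
Proof.
  intros Hx Hc Hd.
  eapply Rle_trans; [apply rsum_abs|].
  apply Rle_trans with (rsum n (fun i => / (2 * c) * (d i * d i) + c / 2)).
  - apply rsum_le; intros i Hi.
    rewrite Rabs_mult.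
    apply Rle_trans with (1 * Rabs (d i)).
    + apply Rmult_le_compat_r; [apply Rabs_pos|auto].
    + assert (Hs : d i * d i = Rabs (d i) * Rabs (d i))
        by (rewrite <- Rabs_mult, Rabs_pos_eq; nra).
      rewrite Hs; set (t := Rabs (d i)).
      apply Rmult_le_reg_l with (2 * c); [lra|].
      replace (2 * c * (/ (2 * c) * (t * t) + c / 2)) with (t * t + c * c) by (field; lra).
      pose proof (Rle_0_sqr (t - c)); unfold Rsqr in *; lra.
  - rewrite rsum_plus, rsum_scal, rsum_const.
    change (rsum n (fun i => d i * d i)) with (normsq n d).
    assert (/ (2 * c) * normsq n d <= / (2 * c) * (c ^ 2 * INR n)).
    { apply Rmult_le_compat_l; [|easy]. left; apply Rinv_0_lt_compat; lra. }
    replace (/ (2 * c) * (c ^ 2 * INR n)) with (c / 2 * INR n) in H by (field; lra).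
    lra.
Qed.

(** * Orthonormal families *)

Definition orthonormal n k (w : nat -> nat -> R) : Prop :=
  forall i j, (i < k)%nat -> (j < k)%nat -> inner n (w i) (w j) = if Nat.eqb j i then 1 else 0.

Definition proj n k (w : nat -> nat -> R) (x : nat -> R) (p : nat) : R :=
  rsum k (fun i => inner n (w i) x * w i p).

Lemma inner_proj n k w x u :
  inner n u (proj n k w x) = rsum k (fun i => inner n (w i) x * inner n u (w i)).
Proof.
  unfold inner at 1, proj.
  transitivity (rsum n (fun p => rsum k (fun i => inner n (w i) x * (u p * w i p)))).
  - apply rsum_ext; intros p _; rewrite <- rsum_scal; apply rsum_ext; intros; ring.
  - rewrite rsum_swap; apply rsum_ext; intros; now rewrite rsum_scal.
Qed.

Lemma inner_basis_proj n k w x j :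
  orthonormal n k w -> (j < k)%nat -> inner n (w j) (proj n k w x) = inner n (w j) x.
Proof.
  intros Hw Hj; rewrite inner_proj.
  rewrite <- (rsum_pick k j (fun i => inner n (w i) x) Hj).
  apply rsum_ext; intros i Hi; rewrite Hw by easy.
  destruct (Nat.eqb i j); ring.
Qed.

Lemma normsq_proj n k w x :
  orthonormal n k w -> normsq n (proj n k w x) = rsum k (fun i => inner n (w i) x ^ 2).
Proof.
  intros Hw; unfold normsq; rewrite inner_proj; apply rsum_ext; intros i Hi.
  rewrite (inner_sym n (proj n k w x)), inner_basis_proj by easy; ring.
Qed.

Lemma normsq_sub_proj n k w x :
  orthonormal n k w ->
  normsq n (fun p => 1 * x p + -1 * proj n k w x p) =
  normsq n x - rsum k (fun i => inner n (w i) x ^ 2).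
Proof.
  intros Hw; rewrite normsq_lin, normsq_proj, inner_proj by easy.
  rewrite (rsum_ext k (fun i => inner n (w i) x * inner n x (w i))
             (fun i => inner n (w i) x ^ 2)); [ring|].
  intros; rewrite (inner_sym n x); ring.
Qed.

Lemma bessel n k w x :
  orthonormal n k w -> rsum k (fun i => inner n (w i) x ^ 2) <= normsq n x.
Proof.
  intros Hw; pose proof (normsq_nonneg n (fun p => 1 * x p + -1 * proj n k w x p)) as H.
  rewrite normsq_sub_proj in H by easy; lra.
Qed.

(** Bessel's inequality, applied to each row of [M] and summed over the rows. *)
Lemma orthonormal_frob M n k w :
  orthonormal n k w -> rsum k (fun i => normsq n (mv M n (w i))) <= frob M n.
Proof.
  intros Hw; unfold normsq at 1, inner; rewrite rsum_swap.
  apply rsum_le; intros p _.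
  eapply Rle_trans; [|eapply Rle_trans; [exact (bessel n k w (M p) Hw)|]].
  - apply rsum_le; intros i _.
    change (mv M n (w i) p) with (inner n (M p) (w i)); rewrite inner_sym; lra.
  - right; apply rsum_ext; intros; ring.
Qed.

Lemma orthonormal_large_count M n k w d :
  orthonormal n k w -> (forall i, (i < k)%nat -> d <= normsq n (mv M n (w i))) ->
  INR k * d <= frob M n.
Proof.
  intros Hw Hd; rewrite <- rsum_const.
  eapply Rle_trans; [apply rsum_le, Hd|]. now apply orthonormal_frob.
Qed.

Definition small_on_complement M n d k w : Prop :=
  forall y, (forall i, (i < k)%nat -> inner n (w i) y = 0) ->
            normsq n (mv M n y) <= d * normsq n y.

(** The violating vector [y] joins the family after normalization, since orthogonality and the lower
    bound are homogeneous. *)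
Lemma orthonormal_extend M n d k w y :
  0 < d -> orthonormal n k w -> (forall i, (i < k)%nat -> d <= normsq n (mv M n (w i))) ->
  (forall i, (i < k)%nat -> inner n (w i) y = 0) -> d * normsq n y < normsq n (mv M n y) ->
  exists w', orthonormal n (S k) w' /\
    forall i, (i < S k)%nat -> d <= normsq n (mv M n (w' i)).
Proof.
  intros Hd Hw Hl Hy Hb.
  (* If [y] vanished, so would [mv M n y], against the strict inequality [Hb]. *)
  assert (Hpos : 0 < normsq n y).
  { destruct (Rle_lt_or_eq_dec _ _ (normsq_nonneg n y)) as [H|H]; [easy|exfalso].
    assert (Hz : forall j, (j < n)%nat -> y j = 0).
    { clear - H; unfold normsq, inner in H; induction n as [|n IH]; [lia|].
      simpl in H; intros j Hj.
      assert (0 <= rsum n (fun i => y i * y i)) by (apply rsum_nonneg; intros; nra).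
      destruct (Nat.eq_dec j n) as [->|ne]; [nra|apply IH; [nra|lia]]. }
    enough (E : normsq n (mv M n y) = 0) by (rewrite E, <- H in Hb; lra).
    unfold normsq, inner; rewrite <- (rsum_zero n); apply rsum_ext; intros i _.
    enough (Hi : mv M n y i = 0) by (rewrite Hi; ring).
    unfold mv; rewrite <- (rsum_zero n); apply rsum_ext; intros j Hj.
    rewrite Hz by easy; ring. }
  set (s := / sqrt (normsq n y)).
  assert (Hs : s * s * normsq n y = 1).
  { unfold s; rewrite <- Rinv_mult, sqrt_sqrt by lra; field; lra. }
  (* The null term gives [e] the shape to which [normsq_lin], [inner_lin] and [mv_lin] apply. *)
  set (e := fun p => s * y p + 0 * y p).
  assert (Ee : normsq n e = 1) by (unfold e; rewrite normsq_lin; lra).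
  assert (Ew : forall i, (i < k)%nat -> inner n (w i) e = 0).
  { intros i Hi; unfold e; rewrite inner_lin, Hy by easy; ring. }
  exists (fun i => if Nat.eqb i k then e else w i); split.
  - intros i j Hi Hj.
    destruct (Nat.eqb_spec i k) as [->|Hik], (Nat.eqb_spec j k) as [->|Hjk].
    + rewrite ?Nat.eqb_refl; exact Ee.
    + destruct (Nat.eqb_spec j k); [lia|]. rewrite inner_sym; apply Ew; lia.
    + destruct (Nat.eqb_spec k i); [lia|]. apply Ew; lia.
    + apply Hw; lia.
  - intros i Hi; destruct (Nat.eqb_spec i k) as [->|Hik]; [|apply Hl; lia].
    assert (E : normsq n (mv M n e) = s * s * normsq n (mv M n y)).
    { transitivity (normsq n (fun p => s * mv M n y p + 0 * mv M n y p)).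
      - apply inner_ext; intros; apply mv_lin.
      - rewrite normsq_lin; ring. }
    rewrite E.
    assert (0 < s * s) by nra.
    assert (s * s * (d * normsq n y) <= s * s * normsq n (mv M n y))
      by (apply Rmult_le_compat_l; lra).
    nra.
Qed.

(* A replacement for the spectral theorem: a maximal orthonormal family of vectors that [M]
   does not shrink below [sqrt d] plays the role of the eigenvectors with large eigenvalue. *)
Lemma few_large_directions M n d :
  0 < d ->
  exists k w, orthonormal n k w /\ INR k * d <= frob M n /\ small_on_complement M n d k w.
Proof.
  intros Hd; apply NNPP; intros Hno.
  (* Otherwise every family could be extended, so families of every size would exist, against the
     bound [frob M n / d] on their size. *)
  assert (H : forall k, exists w, orthonormal n k w /\
             forall i, (i < k)%nat -> d <= normsq n (mv M n (w i))).
  { induction k as [|k [w [Hw Hl]]].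
    - exists (fun _ _ => 0); split; [intros i j Hi; lia|intros; lia].
    - destruct (classic (small_on_complement M n d k w)) as [Hs|Hs].
      + exfalso; apply Hno; exists k, w; repeat split; auto.
        now apply orthonormal_large_count with (w := w).
      + apply not_all_ex_not in Hs as [y Hy]; apply imply_to_and in Hy as [Hy1 Hy2].
        apply (orthonormal_extend M n d k w y); auto; lra. }
  destruct (INR_unbounded (frob M n / d)) as [k Hk].
  destruct (H k) as [w [Hw Hl]].
  pose proof (orthonormal_large_count M n k w d Hw Hl).
  apply (Rmult_lt_compat_r d) in Hk; [|easy].
  unfold Rdiv in Hk; rewrite Rmult_assoc, Rinv_l in Hk; lra.
Qed.

(** Split [y] into its projection [P] on the family and the remainder [Q]. [P] is short, as its
    coordinates are, and [M] stretches it by at most [g]; [Q] has length at most [2 * sqrt n], and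
    [M] shrinks it by [d]. *)
Lemma mv_close_of_coords_close M n g d k w y :
  (forall i j, (i < n)%nat -> (j < n)%nat -> M i j = M j i /\ 0 <= M i j) ->
  (forall i, (i < n)%nat -> rsum n (M i) <= g) -> 0 <= g -> 0 < d ->
  orthonormal n k w -> small_on_complement M n (d ^ 2) k w ->
  rsum k (fun i => inner n (w i) y ^ 2) <= d ^ 2 * INR n ->
  (forall i, (i < n)%nat -> Rabs (y i) <= 2) ->
  normsq n (mv M n y) <= ((2 * g + 4) * d) ^ 2 * INR n.
Proof.
  intros HM Hg Hg0 Hd Hw Hs Hc Hy.
  set (P := proj n k w y). set (Q := fun p => 1 * y p + -1 * P p).
  assert (E : normsq n (mv M n y) = normsq n (fun i => mv M n P i + mv M n Q i)).
  { apply inner_ext; intros i _; unfold Q; rewrite mv_lin; ring. }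
  rewrite E; eapply Rle_trans; [apply normsq_plus_le|].
  assert (HP : normsq n (mv M n P) <= g ^ 2 * (d ^ 2 * INR n)).
  { eapply Rle_trans; [apply schur_test with (g := g); auto|].
    apply Rmult_le_compat_l; [apply pow2_ge_0|].
    unfold P; rewrite normsq_proj; auto. }
  assert (HQ : normsq n (mv M n Q) <= d ^ 2 * (4 * INR n)).
  { eapply Rle_trans.
    - apply Hs; intros i Hi; unfold Q; rewrite inner_lin.
      unfold P; rewrite inner_basis_proj by easy; ring.
    - apply Rmult_le_compat_l; [apply pow2_ge_0|].
      unfold Q, P; rewrite normsq_sub_proj by easy.
      assert (0 <= rsum k (fun i => inner n (w i) y ^ 2))
        by (apply rsum_nonneg; intros; apply pow2_ge_0).
      assert (normsq n y <= INR n * 4); [|lra].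
      rewrite <- rsum_const; apply rsum_le; intros i Hi.
      specialize (Hy i Hi); unfold Rabs in Hy; destruct (Rcase_abs (y i)); nra. }
  assert (0 <= d ^ 2 * INR n)
    by (apply Rmult_le_pos; [apply pow2_ge_0|apply pos_INR]).
  nra.
Qed.

(** * Sums over configurations *)

Definition upd (x : nat -> R) (k : nat) (a : R) (i : nat) : R :=
  if Nat.eqb i k then a else x i.

(** Convertible with the sums in [Z] and [prob_abs_gt]. *)
Definition lsum {T : Type} (l : list T) (G : T -> R) : R := fold_right Rplus 0 (map G l).

Lemma lsum_le {T} (l : list T) G H : (forall x, In x l -> G x <= H x) -> lsum l G <= lsum l H.
Proof.
  induction l as [|a l IH]; unfold lsum in *; simpl; intros Hl; [lra|].
  apply Rplus_le_compat; auto.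
Qed.

Lemma lsum_ext {T} (l : list T) G H : (forall x, In x l -> G x = H x) -> lsum l G = lsum l H.
Proof. intros E; apply Rle_antisym; apply lsum_le; intros; rewrite E; auto; lra. Qed.

Lemma lsum_scal {T} (l : list T) c G : lsum l (fun x => c * G x) = c * lsum l G.
Proof.
  unfold lsum; induction l as [|a l IH]; simpl; [ring|rewrite IH; ring].
Qed.

Lemma lsum_plus {T} (l : list T) G H : lsum l (fun x => G x + H x) = lsum l G + lsum l H.
Proof.
  unfold lsum; induction l as [|a l IH]; simpl; [ring|rewrite IH; ring].
Qed.

Lemma lsum_nonneg {T} (l : list T) G : (forall x, In x l -> 0 <= G x) -> 0 <= lsum l G.
Proof.
  intros H; replace 0 with (0 * lsum l G) by ring; rewrite <- lsum_scal.
  apply lsum_le; intros; rewrite Rmult_0_l; auto.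
Qed.

Lemma lsum_rsum {T} (l : list T) n (G : T -> nat -> R) :
  lsum l (fun x => rsum n (G x)) = rsum n (fun i => lsum l (fun x => G x i)).
Proof.
  induction n as [|n IH]; simpl.
  - transitivity (lsum l (fun _ => 0 * 0)); [apply lsum_ext; intros; ring|].
    rewrite lsum_scal; ring.
  - now rewrite lsum_plus, IH.
Qed.

Lemma lsum_configs_S n G :
  lsum (configs (S n)) G = lsum (configs n) (fun x => G (upd x n 1) + G (upd x n (-1))).
Proof.
  unfold lsum; simpl; induction (configs n) as [|x l IH]; simpl; [easy|].
  rewrite IH; unfold upd; ring.
Qed.

Lemma lsum_configs_0 G : lsum (configs 0) G = G (fun _ => 0).
Proof. unfold lsum; simpl; ring. Qed.

Lemma configs_spin n x i : In x (configs n) -> (i < n)%nat -> x i = 1 \/ x i = -1.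
Proof.
  revert x; induction n as [|n IH]; intros x Hx Hi; [lia|].
  simpl in Hx; apply in_flat_map in Hx as [y [Hy [<-|[<-|[]]]]];
    destruct (Nat.eqb_spec i n); auto; apply IH; auto; lia.
Qed.

Lemma configs_abs n x i : In x (configs n) -> (i < n)%nat -> Rabs (x i) <= 1.
Proof.
  intros Hx Hi; destruct (configs_spin n x i Hx Hi) as [-> | ->]; unfold Rabs; destruct Rcase_abs; lra.
Qed.

Lemma upd_eq x k a : upd x k a k = a.
Proof. unfold upd; now rewrite Nat.eqb_refl. Qed.

Lemma upd_neq x k a i : i <> k -> upd x k a i = x i.
Proof. unfold upd; destruct (Nat.eqb_spec i k); easy. Qed.

Lemma upd_comm x i j a b : i <> j -> upd (upd x i a) j b = upd (upd x j b) i a.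
Proof.
  intros H; apply functional_extensionality; intros p; unfold upd.
  destruct (Nat.eqb_spec p i), (Nat.eqb_spec p j); congruence.
Qed.

Lemma upd_upd x i a b : upd (upd x i a) i b = upd x i b.
Proof.
  apply functional_extensionality; intros p; unfold upd; now destruct (Nat.eqb p i).
Qed.

(** Flipping one spin permutes the configurations; for the last spin it swaps the two summands of
    [lsum_configs_S]. *)
Lemma lsum_configs_flip n j G :
  (j < n)%nat -> lsum (configs n) (fun x => G (upd x j (- x j))) = lsum (configs n) G.
Proof.
  revert G; induction n as [|n IH]; intros G Hj; [lia|].
  rewrite !lsum_configs_S.
  destruct (Nat.eq_dec j n) as [->|ne].
  - apply lsum_ext; intros x _; rewrite !upd_upd, !upd_eq.
    replace (- (1)) with (-1) by ring; replace (- (-1)) with 1 by ring; ring.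
  - rewrite <- (IH (fun x => G (upd x n 1) + G (upd x n (-1)))) by lia.
    apply lsum_ext; intros x _; rewrite !(upd_neq _ n _ j), !(upd_comm x n j) by easy; ring.
Qed.

Lemma lsum_configs_exp n h :
  lsum (configs n) (fun x => exp (rsum n (fun i => h i * x i))) =
  exp (rsum n (fun i => ln (exp (h i) + exp (- h i)))).
Proof.
  induction n as [|n IH]; [now rewrite lsum_configs_0|].
  rewrite lsum_configs_S; simpl rsum.
  rewrite exp_plus, <- IH, exp_ln by (pose proof (exp_pos (h n)); pose proof (exp_pos (- h n)); lra).
  rewrite Rmult_comm, <- lsum_scal; apply lsum_ext; intros x _.
  rewrite !exp_plus, !upd_eq.
  rewrite !(rsum_ext n (fun i => h i * upd x n _ i) (fun i => h i * x i))
    by (intros; rewrite upd_neq by lia; easy).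
  replace (h n * 1) with (h n) by ring; replace (h n * -1) with (- h n) by ring; ring.
Qed.

(** The summand is the density of the product measure under which spin [i] has mean [tanh (h i)]. *)
Lemma lsum_configs_product_measure n h :
  lsum (configs n)
    (fun x => exp (rsum n (fun i => h i * x i - ln (exp (h i) + exp (- h i))))) = 1.
Proof.
  transitivity (lsum (configs n) (fun x =>
    exp (- rsum n (fun i => ln (exp (h i) + exp (- h i)))) * exp (rsum n (fun i => h i * x i)))).
  - apply lsum_ext; intros x _; rewrite <- exp_plus; f_equal.
    replace (- rsum n _) with (-1 * rsum n (fun i => ln (exp (h i) + exp (- h i)))) by ring.
    rewrite <- rsum_scal, <- rsum_plus; apply rsum_ext; intros; ring.
  - rewrite lsum_scal, lsum_configs_exp, <- exp_plus, Rplus_opp_l; apply exp_0.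
Qed.

(** The Gibbs variational principle for a single spin of mean [y]. *)
Lemma entropy_two_point y a b :
  -1 <= y <= 1 ->
  exp ((1 + y) / 2 * a + (1 - y) / 2 * b - (xlnx ((1 + y) / 2) + xlnx ((1 - y) / 2)))
  <= exp a + exp b.
Proof.
  intros Hy; set (q := (1 + y) / 2); set (p := (1 - y) / 2).
  assert (Hq : 0 <= q) by (unfold q; lra). assert (Hp : 0 <= p) by (unfold p; lra).
  assert (Hpq : q + p = 1) by (unfold p, q; field).
  set (L := q * a + p * b - (xlnx q + xlnx p)).
  (* The tangent bound [exp s >= 1 + s] at [s = c - ln t - L]. Adding the cases of [q] and [p]
     leaves exactly [exp L] on the left, by the definition of [L] and [q + p = 1]. *)
  assert (H : forall t c, 0 <= t -> exp L * (t + t * c - xlnx t - t * L) <= exp c).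
  { intros t c Ht; unfold xlnx; destruct (Req_dec_T t 0) as [->|ne].
    - pose proof (exp_pos c); lra.
    - assert (E : exp c = exp L * (t * exp (c - ln t - L))).
      { rewrite <- (exp_ln t) at 1 by lra; rewrite <- !exp_plus; f_equal; ring. }
      rewrite E; apply Rmult_le_compat_l; [left; apply exp_pos|].
      pose proof (exp_ineq1_le (c - ln t - L)).
      apply (Rmult_le_compat_l t) in H; lra. }
  pose proof (H q a Hq) as H1; pose proof (H p b Hp) as H2.
  assert (E : exp L * (q + q * a - xlnx q - q * L) + exp L * (p + p * b - xlnx p - p * L)
    = exp L * ((q + p) + L * (1 - (q + p)))) by (unfold L at 2 3 5; unfold L; ring).
  rewrite Hpq in E; lra.
Qed.

(** Affine in each coordinate separately, written as an average over a spin of mean [a], as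
    [entropy_two_point] needs it. *)
Definition multi_affine n (G : (nat -> R) -> R) : Prop :=
  forall x i a, (i < n)%nat ->
    G (upd x i a) = (1 + a) / 2 * G (upd x i 1) + (1 - a) / 2 * G (upd x i (-1)).

(** The last spin is averaged out by the two-point inequality, and the induction hypothesis applies
    to [G] with that spin frozen at [y n], less its entropy. The vector is cut off to zero from [n]
    on because the members of [configs] are. *)
Lemma gibbs_variational n G y :
  multi_affine n G -> (forall i, (i < n)%nat -> -1 <= y i <= 1) ->
  exp (G (fun i => if Nat.ltb i n then y i else 0) - I_n n y) <=
  lsum (configs n) (fun x => exp (G x)).
Proof.
  revert G; induction n as [|n IH]; intros G HG Hy.
  - rewrite lsum_configs_0; unfold I_n; simpl; right; f_equal; ring.
  - rewrite lsum_configs_S.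
    set (e := xlnx ((1 + y n) / 2) + xlnx ((1 - y n) / 2)).
    apply Rle_trans with (lsum (configs n) (fun x => exp (G (upd x n (y n)) - e))).
    + eapply Rle_trans; [right|apply (IH (fun x => G (upd x n (y n)) - e))].
      * unfold I_n; simpl rsum; fold e.
        replace (upd _ n (y n)) with (fun i => if Nat.ltb i (S n) then y i else 0);
          [f_equal; ring|].
        apply functional_extensionality; intros i; unfold upd.
        destruct (Nat.eqb_spec i n), (Nat.ltb_spec i (S n)), (Nat.ltb_spec i n);
          subst; easy || lia.
      * intros x i a Hi; rewrite !(upd_comm x i n) by lia.
        rewrite HG by lia; field.
      * auto.
    + apply lsum_le; intros x _; rewrite HG by lia; apply entropy_two_point; auto.
Qed.

(** * The hyperbolic tangent *)

Lemma tanh_exp h : tanh h = (exp h - exp (- h)) / (exp h + exp (- h)).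
Proof.
  unfold tanh, sinh, cosh; field.
  pose proof (exp_pos h); pose proof (exp_pos (- h)); lra.
Qed.

Lemma one_plus_tanh h : 1 + tanh h = 2 * exp h / (exp h + exp (- h)).
Proof.
  rewrite tanh_exp; field; pose proof (exp_pos h); pose proof (exp_pos (- h)); lra.
Qed.

Lemma one_minus_tanh h : 1 - tanh h = 2 * exp (- h) / (exp h + exp (- h)).
Proof.
  rewrite tanh_exp; field; pose proof (exp_pos h); pose proof (exp_pos (- h)); lra.
Qed.

(** [exp (h + h)] is the odds ratio of the values 1 and -1 for a spin of mean [tanh h]; this is what
    flipping a spin does to the Gibbs weight. *)
Lemma tanh_tilt h : exp (h + h) * (1 - tanh h) = 1 + tanh h.
Proof.
  rewrite one_plus_tanh, one_minus_tanh, exp_plus.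
  replace (_ * _) with (exp h * exp (- h) * (2 * exp h / (exp h + exp (- h))))
    by (unfold Rdiv; ring).
  rewrite <- exp_plus, Rplus_opp_r, exp_0; ring.
Qed.

Lemma tanh_tilt_opp h : exp (- h + - h) * (1 + tanh h) = 1 - tanh h.
Proof.
  rewrite <- tanh_tilt, <- Rmult_assoc, <- exp_plus.
  replace (- h + - h + (h + h)) with 0 by ring; rewrite exp_0; ring.
Qed.

Lemma tanh_bounds h : -1 < tanh h < 1.
Proof.
  assert (0 < 1 + tanh h /\ 0 < 1 - tanh h); [|lra].
  rewrite one_plus_tanh, one_minus_tanh.
  pose proof (exp_pos h); pose proof (exp_pos (- h)).
  split; apply Rdiv_lt_0_compat; lra.
Qed.

(** The derivative is [1 / cosh ^ 2], which lies between 0 and 1. *)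
Lemma tanh_lipschitz a b : Rabs (tanh a - tanh b) <= Rabs (a - b).
Proof.
  assert (Hc : forall c, 1 <= cosh c).
  { intros c; unfold cosh; pose proof (exp_ineq1_le c); pose proof (exp_ineq1_le (- c)); lra. }
  assert (H : forall a b, a < b -> 0 <= tanh b - tanh a <= b - a).
  { intros u v Huv.
    destruct (MVT_cor2 tanh
      (fun c => (cosh c * cosh c - sinh c * sinh c) / Rsqr (cosh c)) u v Huv) as [c [E _]].
    - intros c _. apply (derivable_pt_lim_div sinh cosh c (cosh c) (sinh c)).
      + apply derivable_pt_lim_sinh.
      + apply derivable_pt_lim_cosh.
      + specialize (Hc c); lra.
    - rewrite E.
      assert (E1 : cosh c * cosh c - sinh c * sinh c = 1).
      { unfold cosh, sinh.
        replace (_ - _) with (exp c * exp (- c)) by field.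
        rewrite <- exp_plus, Rplus_opp_r; apply exp_0. }
      rewrite E1; unfold Rsqr; specialize (Hc c).
      assert (0 < / (cosh c * cosh c)) by (apply Rinv_0_lt_compat; nra).
      assert (/ (cosh c * cosh c) <= / 1) by (apply Rinv_le_contravar; nra).
      unfold Rdiv; nra. }
  destruct (Rtotal_order a b) as [Hab|[->|Hab]].
  - specialize (H _ _ Hab); rewrite (Rabs_minus_sym (tanh a)), (Rabs_minus_sym a).
    rewrite !Rabs_pos_eq; lra.
  - rewrite !Rminus_diag, !Rabs_R0; lra.
  - specialize (H _ _ Hab); rewrite !Rabs_pos_eq; lra.
Qed.

Lemma artanh_tanh h : artanh (tanh h) = h.
Proof.
  unfold artanh; rewrite one_plus_tanh, one_minus_tanh.
  pose proof (exp_pos h); pose proof (exp_pos (- h)).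
  replace (_ / _) with (exp h / exp (- h)) by (field; lra).
  unfold Rdiv; rewrite <- exp_Ropp, Ropp_involutive, <- exp_plus, ln_exp; field.
Qed.

Lemma entropy_tanh h :
  xlnx ((1 + tanh h) / 2) + xlnx ((1 - tanh h) / 2) =
  h * tanh h - ln (exp h + exp (- h)).
Proof.
  pose proof (exp_pos h); pose proof (exp_pos (- h)).
  set (c := exp h + exp (- h)); assert (Hc : 0 < c) by (unfold c; lra).
  pose proof (one_plus_tanh h) as E1; pose proof (one_minus_tanh h) as E2.
  fold c in E1, E2.
  assert (F1 : (1 + tanh h) / 2 = exp h * / c) by (rewrite E1; field; lra).
  assert (F2 : (1 - tanh h) / 2 = exp (- h) * / c) by (rewrite E2; field; lra).
  assert (0 < / c) by now apply Rinv_0_lt_compat.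
  unfold xlnx; pose proof (tanh_bounds h).
  destruct (Req_dec_T _ 0); [lra|]; destruct (Req_dec_T _ 0); [lra|].
  replace (ln ((1 + tanh h) / 2)) with (h - ln c)
    by (rewrite F1, ln_mult, ln_Rinv, ln_exp; lra).
  replace (ln ((1 - tanh h) / 2)) with (- h - ln c)
    by (rewrite F2, ln_mult, ln_Rinv, ln_exp; lra).
  field.
Qed.

(** * Summing over cells *)

Lemma exp_m1_le_half : exp (-1) <= / 2.
Proof.
  replace (-1) with (- (1)) by ring; rewrite exp_Ropp; apply Rinv_le_contravar; [lra|].
  pose proof (exp_ineq1_le 1); lra.
Qed.

(** Level [m] contributes at most [K * exp (- m)], a geometric series of ratio at most one half. *)
Lemma level_sum {T} (l : list T) (a : T -> nat) H K :
  0 <= K -> (forall m, lsum l (fun x => if Nat.eqb (a x) m then H x else 0) <= K) ->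
  lsum l (fun x => H x * exp (- INR (a x))) <= 2 * K.
Proof.
  intros HK HH.
  (* The sharper bound for the levels below [M] is what induction preserves, thanks to
     [exp (-1) <= / 2]. *)
  assert (HM : forall M, lsum l (fun x => if Nat.ltb (a x) M then H x * exp (- INR (a x)) else 0)
               <= 2 * (1 - exp (- INR M)) * K).
  { induction M as [|M IH].
    - rewrite (lsum_ext _ _ (fun x => 0 * 0)) by (intros; simpl; ring).
      rewrite lsum_scal; simpl INR; rewrite Ropp_0, exp_0; lra.
    - rewrite (lsum_ext _ _ (fun x =>
        (if Nat.ltb (a x) M then H x * exp (- INR (a x)) else 0) +
        exp (- INR M) * (if Nat.eqb (a x) M then H x else 0))).
      + rewrite lsum_plus, lsum_scal.
        assert (E : exp (- INR (S M)) = exp (- INR M) * exp (-1))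
          by (rewrite <- exp_plus, S_INR; f_equal; ring).
        pose proof (exp_pos (- INR M)) as Hp; pose proof exp_m1_le_half.
        pose proof (Rmult_le_compat_l _ _ _ (Rlt_le _ _ Hp) (HH M)).
        assert (exp (- INR M) * exp (-1) * K <= exp (- INR M) * / 2 * K)
          by (apply Rmult_le_compat_r, Rmult_le_compat_l; lra).
        rewrite E; lra.
      + intros x _; destruct (Nat.ltb_spec (a x) (S M)), (Nat.ltb_spec (a x) M),
          (Nat.eqb_spec (a x) M) as [e|]; try lia; rewrite ?e; ring. }
  assert (HB : exists M, forall x, In x l -> (a x < M)%nat).
  { clear; induction l as [|y l [M IH]]; [exists 0%nat; easy|].
    exists (Nat.max M (S (a y))); intros x [<-|Hx]; [lia|specialize (IH x Hx); lia]. }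
  destruct HB as [M HB].
  rewrite (lsum_ext _ _ (fun x => if Nat.ltb (a x) M then H x * exp (- INR (a x)) else 0)).
  - eapply Rle_trans; [apply HM|]. pose proof (exp_pos (- INR M)); nra.
  - intros x Hx; specialize (HB x Hx); destruct (Nat.ltb_spec (a x) M); [easy|lia].
Qed.

Lemma exp_le_mono x y : x <= y -> exp x <= exp y.
Proof. intros [H| ->]; [left; now apply exp_increasing|lra]. Qed.

Fixpoint same_cell {T} (z : nat -> T -> Z) (k : nat) (t : nat -> Z) (x : T) : bool :=
  match k with
  | O => true
  | S k => andb (same_cell z k t x) (Z.eqb (z k x) (t k))
  end.

Lemma same_cell_spec {T} (z : nat -> T -> Z) k t x :
  same_cell z k t x = true -> forall i, (i < k)%nat -> z i x = t i.
Proof.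
  induction k as [|k IH]; simpl; intros H i Hi; [lia|].
  apply andb_prop in H as [H1 H2]; apply Z.eqb_eq in H2.
  destruct (Nat.eq_dec i k) as [->|]; [easy|apply IH; auto; lia].
Qed.

Lemma same_cell_ext {T} (z : nat -> T -> Z) k t t' x :
  (forall i, (i < k)%nat -> t i = t' i) -> same_cell z k t x = same_cell z k t' x.
Proof.
  induction k as [|k IH]; simpl; intros H; [easy|].
  rewrite IH, H; auto.
Qed.

(* The factor [exp (- sum |z i x|)] makes the infinitely many possible cells summable, so that
   no explicit count of integer points is needed. *)
Lemma cell_sum {T} (l : list T) (z : nat -> T -> Z) K k G :
  0 <= K ->
  (forall x, In x l -> 0 <= G x) ->
  (forall t, lsum l (fun x => if same_cell z k t x then G x else 0) <= K) ->
  lsum l (fun x => G x * exp (- rsum k (fun i => INR (Z.abs_nat (z i x))))) <= 4 ^ k * K.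
Proof.
  intros HK; revert G; induction k as [|k IH]; intros G HG Ht.
  - simpl. rewrite Rmult_1_l.
    eapply Rle_trans; [|apply (Ht (fun _ => 0%Z))]; simpl.
    apply lsum_le; intros; rewrite Ropp_0, exp_0; lra.
  - set (e := fun x => exp (- rsum k (fun i => INR (Z.abs_nat (z i x))))).
    assert (Hv : forall v, lsum l (fun x => if Z.eqb (z k x) v then G x * e x else 0) <= 4 ^ k * K).
    { intros v; rewrite (lsum_ext _ _ (fun x => (if Z.eqb (z k x) v then G x else 0) * e x)).
      - apply (IH (fun x => if Z.eqb (z k x) v then G x else 0)).
        + intros x Hx; destruct (Z.eqb _ _); [auto|lra].
        + intros t; eapply Rle_trans; [right|apply (Ht (fun i => if Nat.eqb i k then v else t i))].
          apply lsum_ext; intros x _; simpl; rewrite Nat.eqb_refl.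
          rewrite (same_cell_ext z k (fun i => if Nat.eqb i k then v else t i) t).
          * destruct (same_cell z k t x), (Z.eqb (z k x) v); easy.
          * intros i Hi; destruct (Nat.eqb_spec i k); [lia|easy].
      - intros x _; destruct (Z.eqb _ _); ring. }
    rewrite (lsum_ext _ _ (fun x => (G x * e x) * exp (- INR (Z.abs_nat (z k x))))).
    (* One factor 2 is the geometric series of [level_sum], the other the two integers of absolute
       value [m]; zero is counted twice, harmlessly. *)
    + replace (4 ^ S k * K) with (2 * (2 * (4 ^ k * K))) by (simpl; ring).
      apply (level_sum l (fun x => Z.abs_nat (z k x))).
      * pose proof (pow_le 4 k ltac:(lra)); nra.
      * intros m.
        apply Rle_trans with (lsum l (fun x =>
          (if Z.eqb (z k x) (Z.of_nat m) then G x * e x else 0) +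
          (if Z.eqb (z k x) (- Z.of_nat m) then G x * e x else 0))).
        -- apply lsum_le; intros x Hx.
           assert (0 <= G x * e x) by (apply Rmult_le_pos; [auto|left; apply exp_pos]).
           destruct (Nat.eqb_spec (Z.abs_nat (z k x)) m), (Z.eqb_spec (z k x) (Z.of_nat m)),
             (Z.eqb_spec (z k x) (- Z.of_nat m)); try lra; lia.
        -- rewrite lsum_plus; pose proof (Hv (Z.of_nat m)); pose proof (Hv (- Z.of_nat m)%Z); lra.
    + intros x _; unfold e; simpl rsum; rewrite Rmult_assoc, <- exp_plus; do 2 f_equal; ring.
Qed.

(** Quadratic in [t], so that Bessel's inequality controls the sum over the coordinates. *)
Lemma abs_Int_part_le t : INR (Z.abs_nat (Int_part t)) <= t ^ 2 + 2.
Proof.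
  rewrite INR_IZR_INZ, Zabs2Nat.id_abs, abs_IZR.
  destruct (base_Int_part t) as [H1 H2].
  unfold Rabs; destruct Rcase_abs; nra.
Qed.

(** * The Ising model *)

Section Ising.
Variables (A : nat -> nat -> nat -> R) (beta B g : R) (n : nat).
Hypothesis HM : forall i j, (i < n)%nat -> (j < n)%nat -> A n i j = A n j i /\ 0 <= A n i j.
Hypothesis Hdiag : forall i, (i < n)%nat -> A n i i = 0.
Hypothesis Hrow : forall i, (i < n)%nat -> rsum n (A n i) <= g.
Hypothesis Hg : 0 <= g.
Hypothesis Hbeta : 0 < beta.

Local Notation w := (weight A beta B n).
Local Notation b := (b_vec A beta B n).
Local Notation F y := (f_n A beta B n y - I_n n y).

(** Spin [j] minus its conditional mean given the other spins. *)
Definition residual (x : nat -> R) (j : nat) : R := x j - b x j.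

(** * Single-spin updates and the lower bound on the partition function *)

Lemma quad_inner y : quad A n y = inner n y (mv (A n) n y).
Proof.
  apply rsum_ext; intros i _; unfold mv; rewrite <- rsum_scal; apply rsum_ext; intros; ring.
Qed.

Lemma mv_upd x i a p : (i < n)%nat ->
  mv (A n) n (upd x i a) p = mv (A n) n x p + A n p i * (a - x i).
Proof.
  intros Hi; rewrite <- (rsum_pick n i (fun i' => A n p i' * (a - x i')) Hi).
  unfold mv; rewrite <- rsum_plus; apply rsum_ext; intros j _; unfold upd.
  destruct (Nat.eqb j i); ring.
Qed.

Lemma inner_upd x i a v : (i < n)%nat ->
  inner n (upd x i a) v = inner n x v + (a - x i) * v i.
Proof.
  intros Hi; rewrite <- (rsum_pick n i (fun i' => (a - x i') * v i') Hi).
  unfold inner; rewrite <- rsum_plus; apply rsum_ext; intros j _; unfold upd.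
  destruct (Nat.eqb j i); ring.
Qed.

Lemma rsum_upd x i a : (i < n)%nat -> rsum n (upd x i a) = rsum n x + (a - x i).
Proof.
  intros Hi; rewrite <- (rsum_pick n i (fun i' => a - x i') Hi).
  rewrite <- rsum_plus; apply rsum_ext; intros j _; unfold upd.
  destruct (Nat.eqb j i); ring.
Qed.

Lemma inner_mv_sym_A u v : inner n u (mv (A n) n v) = inner n v (mv (A n) n u).
Proof. apply inner_mv_sym; intros; now apply HM. Qed.

(** Exact and not only first order: the zero diagonal removes the term quadratic in [a - x i]. *)
Lemma f_n_upd x i a : (i < n)%nat ->
  f_n A beta B n (upd x i a) =
  f_n A beta B n x + (a - x i) * (beta * m_i A n x i + B).
Proof.
  intros Hi; unfold f_n; rewrite !quad_inner, rsum_upd, inner_upd, mv_upd, Hdiag by easy.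
  rewrite inner_mv_sym_A, inner_upd by easy.
  change (m_i A n x i) with (mv (A n) n x i); field.
Qed.

Lemma b_upd_self x i a : (i < n)%nat -> b (upd x i a) i = b x i.
Proof.
  intros Hi; unfold b_vec; change (m_i A n) with (mv (A n) n).
  rewrite mv_upd, Hdiag by easy; do 2 f_equal; ring.
Qed.

Lemma f_n_multi_affine : multi_affine n (f_n A beta B n).
Proof. intros x i a Hi; rewrite !(f_n_upd x i _ Hi); field. Qed.

Lemma Z_lower_bound y :
  (forall i, (i < n)%nat -> -1 <= y i <= 1) -> exp (F y) <= Defs.Z A beta B n.
Proof.
  intros Hy; eapply Rle_trans; [|apply (gibbs_variational n (f_n A beta B n) y)];
    [|apply f_n_multi_affine|easy].
  right; do 2 f_equal.
  (* [y] is arbitrary from index [n] on, whereas the variational bound evaluates [f_n] at its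
     cut-off [y']. *)
  set (y' := fun i => _). assert (E : forall i, (i < n)%nat -> y i = y' i).
  { intros i Hi; unfold y'; destruct (Nat.ltb_spec i n); [easy|lia]. }
  unfold f_n; rewrite !quad_inner, (rsum_ext n y y' E).
  rewrite (inner_ext n y _ y' (mv (A n) n y')); auto.
  intros; apply mv_ext; auto.
Qed.

Lemma Z_pos : 0 < Defs.Z A beta B n.
Proof.
  eapply Rlt_le_trans; [apply exp_pos|apply (Z_lower_bound (fun _ => 0))]; intros; lra.
Qed.

(** * Second moment of the matrix applied to the residual *)

Lemma b_bounds x i : -1 < b x i < 1.
Proof. apply tanh_bounds. Qed.

(** Conditional centering, proved by symmetry: flipping spin [j] turns each summand into the
    negative of the original one, so the sum equals its own negative. *)
Lemma residual_orthogonal j h :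
  (j < n)%nat -> (forall x a, h (upd x j a) = h x) ->
  lsum (configs n) (fun x => w x * (residual x j * h x)) = 0.
Proof.
  intros Hj Hh; set (G := fun x => w x * (residual x j * h x)).
  assert (E : lsum (configs n) G = -1 * lsum (configs n) G); [|lra].
  rewrite <- lsum_scal, <- (lsum_configs_flip n j G Hj) at 1.
  apply lsum_ext; intros x Hx; unfold G, residual, weight.
  rewrite Hh, upd_eq, b_upd_self, f_n_upd by easy.
  unfold b_vec at 1 2; set (t := beta * m_i A n x j + B).
  rewrite exp_plus; destruct (configs_spin n x j Hx Hj) as [-> | ->].
  - replace ((- (1) - 1) * t) with (- t + - t) by ring.
    pose proof (tanh_tilt_opp t) as E.
    replace (- (1) - tanh t) with (- (1 + tanh t)) by ring.
    rewrite <- E; ring.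
  - replace ((- (-1) - -1) * t) with (t + t) by ring.
    pose proof (tanh_tilt t) as E.
    replace (- (-1) - tanh t) with (1 - tanh t) by ring.
    replace (-1 - tanh t) with (- (1 + tanh t)) by ring.
    rewrite <- E; ring.
Qed.

Lemma residual_abs x j : In x (configs n) -> (j < n)%nat -> Rabs (residual x j) <= 2.
Proof.
  intros Hx Hj; unfold residual; pose proof (b_bounds x j).
  destruct (configs_spin n x j Hx Hj) as [-> | ->]; unfold Rabs; destruct Rcase_abs; lra.
Qed.

Lemma residual_upd_other x j k :
  In x (configs n) -> (j < n)%nat -> (k < n)%nat -> k <> j ->
  Rabs (residual x k - residual (upd x j 0) k) <= beta * A n k j.
Proof.
  intros Hx Hj Hk Hne; unfold residual; rewrite upd_neq by easy.
  replace (_ - _) with (b (upd x j 0) k - b x k) by ring.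
  unfold b_vec; eapply Rle_trans; [apply tanh_lipschitz|].
  change (m_i A n) with (mv (A n) n); rewrite mv_upd by easy.
  replace (_ - _) with (beta * A n k j * (- x j)) by ring.
  destruct (HM k j Hk Hj) as [_ H0].
  assert (0 <= beta * A n k j) by (apply Rmult_le_pos; lra).
  rewrite Rabs_mult, Rabs_Ropp, (Rabs_pos_eq (beta * _)) by easy.
  pose proof (configs_abs n x j Hx Hj); nra.
Qed.

(** Erasing spin [j] from the residual at [k] costs at most [beta * A n k j], times 2 for the other
    residual; the erased product sums to zero by [residual_orthogonal]. On the diagonal the bound 4
    is trivial. *)
Lemma residual_correlation j k : (j < n)%nat -> (k < n)%nat ->
  lsum (configs n) (fun x => w x * (residual x j * residual x k)) <=
  (2 * beta * A n k j + if Nat.eqb k j then 4 else 0) * Defs.Z A beta B n.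
Proof.
  intros Hj Hk.
  change (Defs.Z A beta B n) with (lsum (configs n) w).
  destruct (HM k j Hk Hj) as [_ H0].
  assert (0 <= beta * A n k j) by (apply Rmult_le_pos; lra).
  destruct (Nat.eqb_spec k j) as [->|Hne].
  - rewrite <- lsum_scal; apply lsum_le; intros x Hx; rewrite Rmult_comm.
    apply Rmult_le_compat_r; [left; apply exp_pos|].
    pose proof (residual_abs x j Hx Hj) as H1.
    unfold Rabs in H1; destruct Rcase_abs; nra.
  - set (h := fun x => residual (upd x j 0) k).
    apply Rle_trans with
      (lsum (configs n) (fun x => 2 * beta * A n k j * w x + w x * (residual x j * h x))).
    + apply lsum_le; intros x Hx.
      assert (Hd : residual x j * (residual x k - h x) <= 2 * (beta * A n k j)).
      { eapply Rle_trans; [apply Rle_abs|]; rewrite Rabs_mult.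
        apply Rmult_le_compat; try apply Rabs_pos; [now apply residual_abs|].
        now apply residual_upd_other. }
      apply (Rmult_le_compat_l (w x)) in Hd; [lra|left; apply exp_pos].
    + rewrite lsum_plus, lsum_scal, residual_orthogonal; [lra|easy|].
      intros; unfold h; now rewrite upd_upd.
Qed.

Lemma residual_second_moment :
  lsum (configs n) (fun x => w x * normsq n (mv (A n) n (residual x))) <=
  (2 * beta * g + 4) * frob (A n) n * Defs.Z A beta B n.
Proof.
  set (a := A n) in *.
  rewrite (lsum_ext _ _ (fun x => rsum n (fun i => rsum n (fun j => rsum n (fun k =>
    a i j * a i k * (w x * (residual x j * residual x k))))))).
  2:{ intros x _; unfold normsq, inner, mv.
      rewrite <- rsum_scal; apply rsum_ext; intros i _.
      set (S := rsum n (fun j => a i j * residual x j)).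
      transitivity (rsum n (fun j => w x * S * (a i j * residual x j)));
        [rewrite rsum_scal; fold S; ring|].
      apply rsum_ext; intros j _.
      transitivity (rsum n (fun k => w x * (a i j * residual x j) * (a i k * residual x k)));
        [rewrite rsum_scal; fold S; ring|].
      apply rsum_ext; intros k _; ring. }
  rewrite lsum_rsum.
  replace (_ * frob a n * _) with ((2 * beta * g + 4) * Defs.Z A beta B n * frob a n) by ring.
  unfold frob; rewrite <- rsum_scal; apply rsum_le; intros i Hi.
  rewrite lsum_rsum.
  (* By [2 * a i j * a i k <= a i j ^ 2 + a i k ^ 2], each off-diagonal term holds one squared entry
     of row [i] and a factor [a k j] to be summed by the row bound. *)
  apply Rle_trans with (rsum n (fun j => rsum n (fun k =>
    Defs.Z A beta B n * (beta * (a k j * a i j ^ 2 + a k j * a i k ^ 2)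
      + if Nat.eqb k j then 4 * a i j * a i k else 0)))).
  - apply rsum_le; intros j Hj; rewrite lsum_rsum; apply rsum_le; intros k Hk.
    rewrite lsum_scal.
    assert (0 <= a i j * a i k) by (apply Rmult_le_pos; now apply HM).
    eapply Rle_trans.
    + apply Rmult_le_compat_l; [easy|]. now apply residual_correlation.
    + fold a.
      replace (a i j * a i k * ((2 * beta * a k j + (if (k =? j)%nat then 4 else 0)) * Defs.Z A beta B n))
        with (Defs.Z A beta B n * (beta * (a k j * (2 * a i j * a i k)) +
               (if (k =? j)%nat then 4 * a i j * a i k else 0)))
        by (destruct (Nat.eqb k j); ring).
      apply Rmult_le_compat_l; [left; apply Z_pos|].
      apply Rplus_le_compat_r, Rmult_le_compat_l; [lra|].
      rewrite <- Rmult_plus_distr_l; apply Rmult_le_compat_l; [now apply HM|].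
      pose proof (pow2_ge_0 (a i j - a i k)); nra.
  - rewrite (Rmult_comm _ (Defs.Z A beta B n)), Rmult_assoc.
    rewrite (rsum_ext n _ (fun j => Defs.Z A beta B n *
       (beta * (rsum n (fun k => a k j * a i j ^ 2 + a k j * a i k ^ 2)) + 4 * a i j ^ 2))).
    2:{ intros j Hj; rewrite rsum_scal, rsum_plus, rsum_scal, rsum_pick by easy; ring. }
    rewrite rsum_scal; apply Rmult_le_compat_l; [left; apply Z_pos|].
    rewrite rsum_plus, !rsum_scal.
    set (V := rsum n (fun j => a i j ^ 2)).
    enough (rsum n (fun j => rsum n (fun k => a k j * a i j ^ 2 + a k j * a i k ^ 2))
            <= 2 * g * V) by nra.
    (* Symmetry and an exchange of summations turn both halves into the same double sum, at most
       [g * V]. *)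
    rewrite (rsum_ext n _ (fun j => rsum n (fun k => a i j ^ 2 * a j k)
               + rsum n (fun k => a k j * a i k ^ 2))).
    2:{ intros j Hj; rewrite <- rsum_plus; apply rsum_ext; intros k Hk.
        rewrite (proj1 (HM j k Hj Hk)); ring. }
    rewrite rsum_plus, (rsum_swap n n (fun j k => a k j * a i k ^ 2)).
    rewrite (rsum_ext n (fun k => rsum n (fun j => a k j * a i k ^ 2))
               (fun k => rsum n (fun j => a i k ^ 2 * a k j)))
      by (intros; apply rsum_ext; intros; ring).
    enough (rsum n (fun j => rsum n (fun k => a i j ^ 2 * a j k)) <= g * V) by lra.
    unfold V; rewrite <- rsum_scal; apply rsum_le; intros j Hj.
    rewrite rsum_scal, (Rmult_comm g); apply Rmult_le_compat_l; [apply pow2_ge_0|].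
    now apply Hrow.
Qed.

(** Markov's inequality for the second moment. *)
Lemma residual_tail d : 0 < d -> (0 < n)%nat ->
  lsum (configs n) (fun x =>
    if Rlt_dec (d ^ 2 * INR n) (normsq n (mv (A n) n (residual x))) then w x else 0) <=
  (2 * beta * g + 4) / d ^ 2 * (/ INR n * frob (A n) n) * Defs.Z A beta B n.
Proof.
  intros Hd Hn; apply lt_0_INR in Hn.
  set (s := d ^ 2 * INR n).
  assert (Hs : 0 < s) by (apply Rmult_lt_0_compat; [apply pow_lt|]; easy).
  apply Rle_trans with (lsum (configs n) (fun x =>
    / s * (w x * normsq n (mv (A n) n (residual x))))).
  - apply lsum_le; intros x _.
    assert (0 < w x) by apply exp_pos.
    assert (0 < / s) by now apply Rinv_0_lt_compat.
    pose proof (normsq_nonneg n (mv (A n) n (residual x))).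
    destruct (Rlt_dec _ _) as [Hlt|_].
    + apply Rmult_le_reg_l with s; [easy|].
      rewrite <- Rmult_assoc, Rinv_r, Rmult_1_l by lra; nra.
    + apply Rmult_le_pos; [lra|]; apply Rmult_le_pos; lra.
  - rewrite lsum_scal.
    eapply Rle_trans.
    + apply Rmult_le_compat_l; [left; now apply Rinv_0_lt_compat|apply residual_second_moment].
    + right; unfold s; field; lra.
Qed.

(** * Mass of the configurations with a low variational value *)

Lemma I_n_b x :
  I_n n (b x) = rsum n (fun i => (beta * m_i A n x i + B) * b x i
     - ln (exp (beta * m_i A n x i + B) + exp (- (beta * m_i A n x i + B)))).
Proof. apply rsum_ext; intros; apply entropy_tanh. Qed.

Lemma field_inner x u :
  rsum n (fun i => (beta * m_i A n x i + B) * u i) =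
  beta * inner n u (mv (A n) n x) + B * rsum n u.
Proof.
  unfold inner; rewrite <- !rsum_scal, <- rsum_plus; apply rsum_ext; intros.
  change (m_i A n) with (mv (A n) n); ring.
Qed.

(* Near [x0], the Gibbs weight is bounded by [exp (F (b x0))] times the product measure with
   mean [b x0]; the error is linear in [A (x - x0)] and [A (x0 - b x0)]. *)
Lemma weight_le_product_measure x0 x c d :
  In x0 (configs n) -> In x (configs n) -> 0 < c -> 0 < d ->
  normsq n (mv (A n) n (fun i => 1 * x i + -1 * x0 i)) <= c ^ 2 * INR n ->
  normsq n (mv (A n) n (residual x0)) <= d ^ 2 * INR n ->
  w x <= exp (F (b x0) + beta * (c + d) * INR n) *
    exp (rsum n (fun i => (beta * m_i A n x0 i + B) * x i
      - ln (exp (beta * m_i A n x0 i + B) + exp (- (beta * m_i A n x0 i + B))))).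
Proof.
  intros Hx0 Hx Hc Hd HC HD; unfold weight; rewrite <- exp_plus.
  apply exp_le_mono.
  set (u := b x0); set (Q := fun y z => inner n y (mv (A n) n z)).
  set (L := rsum n (fun i => -1 * ln (exp (beta * m_i A n x0 i + B) + exp (- (beta * m_i A n x0 i + B))))).
  (* At [y = x] this is the log-density of the product measure, at [y = u] the entropy of [b x0];
     hence [L] and the terms in [B] cancel. *)
  assert (E : forall y, rsum n (fun i => (beta * m_i A n x0 i + B) * y i
      - ln (exp (beta * m_i A n x0 i + B) + exp (- (beta * m_i A n x0 i + B))))
      = beta * Q y x0 + B * rsum n y + L).
  { intros y; unfold Q; rewrite <- field_inner; unfold L; rewrite <- rsum_plus.
    apply rsum_ext; intros; ring. }
  rewrite E; unfold u at 2; rewrite I_n_b; fold u; rewrite E; unfold f_n; rewrite !quad_inner; fold (Q x x) (Q u u).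
  assert (Hlin : forall y v1 v2, inner n y (mv (A n) n (fun i => 1 * v1 i + -1 * v2 i)) = Q y v1 - Q y v2).
  { intros y v1 v2; unfold Q.
    rewrite (inner_ext n y _ y (fun i => 1 * mv (A n) n v1 i + -1 * mv (A n) n v2 i)); auto.
    - rewrite inner_lin; ring.
    - intros; apply mv_lin. }
  assert (HD' : normsq n (mv (A n) n (fun i => 1 * x0 i + -1 * u i)) <= d ^ 2 * INR n).
  { eapply Rle_trans; [right|exact HD].
    apply inner_ext; intros; apply mv_ext; intros; unfold residual, u; ring. }
  assert (Hu : forall i, (i < n)%nat -> Rabs (u i) <= 1).
  { intros i _; pose proof (b_bounds x0 i); unfold u, Rabs; destruct Rcase_abs; lra. }
  assert (Habs : forall t s, Rabs t <= s -> - s <= t <= s).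
  { intros t s; unfold Rabs; destruct Rcase_abs; lra. }
  pose proof (Habs _ _ (inner_cube_bound n x _ c (fun i => configs_abs n x i Hx) Hc HC)) as H1.
  pose proof (Habs _ _ (inner_cube_bound n x0 _ c (fun i => configs_abs n x0 i Hx0) Hc HC)) as H2.
  pose proof (Habs _ _ (inner_cube_bound n x0 _ d (fun i => configs_abs n x0 i Hx0) Hd HD')) as H3.
  pose proof (Habs _ _ (inner_cube_bound n u _ d Hu Hd HD')) as H4.
  rewrite Hlin in H1, H2, H3, H4.
  assert (S1 : Q x0 x = Q x x0) by apply inner_mv_sym_A.
  assert (S2 : Q x0 u = Q u x0) by apply inner_mv_sym_A.
  rewrite S1 in H2; rewrite S2 in H3.
  (* This is [H1 - H2 - H3 + H4], in which [Q x0 x0] cancels. *)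
  assert (HT : Q x x - 2 * Q x x0 + 2 * Q u x0 - Q u u <= 2 * (c + d) * INR n) by lra.
  apply (Rmult_le_compat_l (beta / 2)) in HT; [lra|lra].
Qed.

(** The first factor pays for the number of cells, the second bounds the mass of one cell;
    [2 * g + 5] adds the cell diameter [2 * g + 4] and the residual bound 1, in units of [d]. *)
Lemma low_value_mass d eps r : 0 < d -> (0 < n)%nat ->
  lsum (configs n) (fun x =>
    if Rle_dec (normsq n (mv (A n) n (residual x))) (d ^ 2 * INR n)
    then if Rlt_dec (F (b x)) (r - INR n * eps) then w x else 0 else 0) <=
  exp ((4 + / d ^ 2) * (/ d ^ 2 * frob (A n) n + 1)) *
  exp (r - INR n * eps + beta * ((2 * g + 5) * d) * INR n).
Proof.
  intros Hd Hn; apply lt_0_INR in Hn.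
  set (G := fun x => if Rle_dec _ _ then _ else 0).
  set (K := exp (r - _ + _)).
  assert (HG : forall x, 0 <= G x).
  { intros x; unfold G; destruct (Rle_dec _ _); [destruct (Rlt_dec _ _)|]; try lra; left; apply exp_pos. }
  assert (Hd2 : 0 < d ^ 2) by now apply pow_lt.
  assert (Hid2 : 0 < / d ^ 2) by now apply Rinv_0_lt_compat.
  destruct (few_large_directions (A n) n (d ^ 2) Hd2) as [k [v [Hv [Hk Hsmall]]]].
  assert (Hk0 : 0 <= INR k) by apply pos_INR.
  (* The mesh is such that [k * s ^ 2 <= d ^ 2 * n]; [k + 1] avoids a division by zero for an empty
     family. *)
  set (s := d * sqrt (INR n / (INR k + 1))).
  assert (Hq : 0 < INR n / (INR k + 1)) by (apply Rdiv_lt_0_compat; lra).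
  assert (Hs : 0 < s) by (apply Rmult_lt_0_compat; [easy|now apply sqrt_lt_R0]).
  assert (Hs2 : s ^ 2 = d ^ 2 * INR n / (INR k + 1)).
  { unfold s; rewrite Rpow_mult_distr, pow2_sqrt by lra; unfold Rdiv; ring. }
  assert (His : 0 < / s) by now apply Rinv_0_lt_compat.
  set (z := fun i x => Int_part (inner n (v i) x / s)).
  assert (Hcell : forall t,
    lsum (configs n) (fun x => if same_cell z k t x then G x else 0) <= K).
  { intros t.
    (* Any contributing configuration of the cell serves as its reference point; without one the
       cell sum vanishes. *)
    destruct (classic (exists x0, In x0 (configs n) /\ same_cell z k t x0 = true /\ G x0 <> 0))
      as [[x0 [Hx0 [Hc0 HG0]]]|Hno].
    - set (D := fun i => beta * m_i A n x0 i + B).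
      apply Rle_trans with (lsum (configs n) (fun x => K *
        exp (rsum n (fun i => D i * x i - ln (exp (D i) + exp (- D i)))))).
      + apply lsum_le; intros x Hx.
        assert (HK : forall t, 0 <= K * exp t)
          by (intros; apply Rmult_le_pos; left; apply exp_pos).
        destruct (same_cell z k t x) eqn:Hc; [|apply HK].
        unfold G in HG0.
        destruct (Rle_dec _ _) as [Hr0|]; [|easy]; destruct (Rlt_dec _ _) as [Hlow|]; [|easy].
        apply Rle_trans with (w x).
        { unfold G; pose proof (exp_pos (f_n A beta B n x)); unfold weight.
          destruct (Rle_dec _ _); [destruct (Rlt_dec _ _)|]; lra. }
        eapply Rle_trans.
        * apply (weight_le_product_measure x0 x ((2 * g + 4) * d) d); auto; [nra|].
          apply mv_close_of_coords_close with (k := k) (w := v); auto.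
          -- apply Rle_trans with (rsum k (fun _ => s ^ 2)).
             ++ apply rsum_le; intros i Hi; rewrite inner_lin.
                pose proof (same_cell_spec z k t x Hc i Hi) as E1.
                rewrite <- (same_cell_spec z k t x0 Hc0 i Hi) in E1; unfold z in E1.
                destruct (base_Int_part (inner n (v i) x / s)) as [B1 B2].
                destruct (base_Int_part (inner n (v i) x0 / s)) as [B3 B4].
                rewrite E1 in B1, B2.
                assert (Hle : -1 <= inner n (v i) x / s - inner n (v i) x0 / s <= 1) by lra.
                replace (1 * inner n (v i) x + -1 * inner n (v i) x0)
                  with (s * (inner n (v i) x / s - inner n (v i) x0 / s)) by (field; lra).
                set (q := inner n (v i) x / s - inner n (v i) x0 / s) in *.
                assert (q ^ 2 <= 1) by nra.
                rewrite Rpow_mult_distr; pose proof (pow2_ge_0 s); nra.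
             ++ rewrite rsum_const, Hs2.
                apply Rmult_le_reg_r with (INR k + 1); [lra|].
                field_simplify; [|lra]. nra.
          -- intros i Hi; pose proof (configs_spin n x i Hx Hi).
             pose proof (configs_spin n x0 i Hx0 Hi).
             unfold Rabs; destruct Rcase_abs; destruct H, H0; lra.
        * fold D; apply Rmult_le_compat_r; [left; apply exp_pos|].
          apply exp_le_mono; lra.
      + rewrite lsum_scal, lsum_configs_product_measure; lra.
    - eapply Rle_trans with (lsum (configs n) (fun _ => 0 * 0)).
      + apply lsum_le; intros x Hx; destruct (same_cell z k t x) eqn:Hc; [|lra].
        destruct (Req_dec (G x) 0); [lra|].
        exfalso; apply Hno; exists x; auto.
      + rewrite lsum_scal; pose proof (exp_pos (r - INR n * eps + beta * ((2 * g + 5) * d) * INR n)).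
        unfold K; lra. }
  pose proof (cell_sum (configs n) z K k G (Rlt_le _ _ (exp_pos _)) (fun x _ => HG x) Hcell) as Hsum.
  (* [T] dominates the sum of the [|z i x|] for every configuration, by Bessel and
     [normsq n x <= n], so removing the damping factor of [cell_sum] costs at most [exp T]. *)
  set (T := (INR k + 1) * / d ^ 2 + 2 * INR k).
  assert (Hlb : lsum (configs n) G <= exp T * (4 ^ k * K)).
  { eapply Rle_trans; [|apply Rmult_le_compat_l; [left; apply exp_pos|exact Hsum]].
    rewrite <- lsum_scal; apply lsum_le; intros x Hx.
    assert (HN : rsum k (fun i => INR (Z.abs_nat (z i x))) <= T).
    { apply Rle_trans with (rsum k (fun i => / s ^ 2 * inner n (v i) x ^ 2 + 2)).
      - apply rsum_le; intros i _; unfold z.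
        eapply Rle_trans; [apply abs_Int_part_le|right]; field; lra.
      - rewrite rsum_plus, rsum_scal, rsum_const.
        assert (Hb : rsum k (fun i => inner n (v i) x ^ 2) <= INR n).
        { eapply Rle_trans; [now apply bessel|].
          rewrite <- (Rmult_1_r (INR n)), <- rsum_const; apply rsum_le; intros i Hi.
          destruct (configs_spin n x i Hx Hi) as [-> | ->]; lra. }
        apply (Rmult_le_compat_l (/ s ^ 2)) in Hb.
        + replace (/ s ^ 2 * INR n) with ((INR k + 1) * / d ^ 2) in Hb
            by (rewrite Hs2; field; lra).
          unfold T; lra.
        + left; apply Rinv_0_lt_compat, pow_lt; easy. }
    set (N := rsum k _) in *.
    replace (exp T * (G x * exp (- N))) with (G x * exp (T + - N)) by (rewrite exp_plus; ring).
    pose proof (exp_ineq1_le (T + - N)).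
    rewrite <- (Rmult_1_r (G x)) at 1; apply Rmult_le_compat_l; [apply HG|lra]. }
  eapply Rle_trans; [exact Hlb|].
  rewrite <- Rmult_assoc; apply Rmult_le_compat_r; [left; apply exp_pos|].
  assert (H4 : 4 ^ k <= exp (2 * INR k)).
  { clear; induction k as [|k IH]; [simpl; rewrite Rmult_0_r, exp_0; lra|].
    rewrite S_INR; replace (2 * (INR k + 1)) with (1 + 1 + 2 * INR k) by ring.
    rewrite !exp_plus; pose proof (exp_ineq1_le 1); pose proof (pow_le 4 k ltac:(lra)).
    simpl; apply Rmult_le_compat; nra. }
  eapply Rle_trans; [apply Rmult_le_compat_l; [left; apply exp_pos|exact H4]|].
  rewrite <- exp_plus; apply exp_le_mono; unfold T.
  assert (INR k <= / d ^ 2 * frob (A n) n).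
  { apply Rmult_le_reg_r with (d ^ 2); [easy|].
    replace (/ d ^ 2 * frob (A n) n * d ^ 2) with (frob (A n) n) by (field; lra); easy. }
  nra.
Qed.
End Ising.

(** * Convergence in probability *)

Theorem theorem6 (A : nat -> nat -> nat -> R) (beta B : R) (r : nat -> R) :
  symmetric_nonneg_zero_diag A ->
  cond_C1 A ->
  mean_field A ->
  0 < beta -> B <> 0 ->
  (forall n, is_lub (FI_values A beta B n) (r n)) ->
  conv_prob_zero A beta B
    (fun n x => / INR n * (f_n A beta B n (b_vec A beta B n x)
                           - I_n n (b_vec A beta B n x) - r n))
  /\
  conv_prob_zero A beta B
    (fun n x => / sqrt (INR n) * grad_norm A beta B n (b_vec A beta B n x)).
Proof.
  intros HA [g Hrow] Hmf Hbeta _ Hr.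
  (* [g] dominates the row sum of the 1 by 1 matrix, whose only entry is diagonal and hence zero. *)
  assert (Hg : 0 <= g).
  { pose proof (Hrow 1%nat 0%nat ltac:(lia)) as H; simpl in H.
    rewrite (proj2 (HA 1%nat) 0%nat) in H by lia; lra. }
  assert (HM := fun n => proj1 (HA n)). assert (Hdiag := fun n => proj2 (HA n)).
  set (C2 := 2 * beta * g + 4).
  assert (HC2 : 0 < C2) by (unfold C2; nra).
  assert (Hpr0 : forall n Y eps, 0 <= prob_abs_gt A beta B n Y eps).
  { intros n Y eps; unfold prob_abs_gt; apply Rmult_le_pos.
    - apply lsum_nonneg; intros x _; destruct (Rlt_dec _ _); [left; apply exp_pos|lra].
    - left; apply Rinv_0_lt_compat, Z_pos; auto. }
  assert (Hmf' : forall tau, 0 < tau -> exists N, forall n, (n >= N)%nat ->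
            / INR n * frob (A n) n < tau).
  { intros tau Ht; destruct (Hmf tau Ht) as [N HN]; exists N; intros n Hn.
    specialize (HN n Hn); unfold R_dist in HN; rewrite Rminus_0_r in HN.
    eapply Rle_lt_trans; [apply Rle_abs|exact HN]. }
  split; intros eps Heps eta Heta.
  (* With this [d] the linearization error uses up half of the gain [eps * n]. *)
  - set (d := eps / (2 * beta * (2 * g + 5))).
    assert (Hd : 0 < d) by (apply Rdiv_lt_0_compat; nra).
    assert (Hd2 : 0 < d ^ 2) by now apply pow_lt.
    assert (Hid2 : 0 < / d ^ 2) by now apply Rinv_0_lt_compat.
    assert (Ed : beta * ((2 * g + 5) * d) = eps / 2) by (unfold d; field; lra).
    set (C := 4 + / d ^ 2).
    assert (HC : 0 < C) by (unfold C; lra).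
    (* [N1] makes the tail at most [eta / 2]; [N2] and [N3] make the cell exponent and the constants
       each cost at most [eps * n / 4]. *)
    destruct (Hmf' (eta / 2 * d ^ 2 / C2)) as [N1 HN1];
      [apply Rdiv_lt_0_compat; nra|].
    destruct (Hmf' (eps / 4 * d ^ 2 / C)) as [N2 HN2];
      [apply Rdiv_lt_0_compat; nra|].
    destruct (INR_unbounded ((C + 2 / eta) * (4 / eps))) as [N3 HN3].
    exists (S (N1 + N2 + N3)); intros n Hn.
    assert (Hn0 : (0 < n)%nat) by lia; assert (Hn1 := lt_0_INR n Hn0).
    specialize (HN1 n ltac:(lia)); specialize (HN2 n ltac:(lia)).
    assert (HZ : 0 < Defs.Z A beta B n) by (apply Z_pos; auto).
    unfold R_dist; rewrite Rminus_0_r, Rabs_pos_eq by apply Hpr0.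
    pose proof (residual_tail A beta B g n (HM n) (Hdiag n) (Hrow n) Hbeta d Hd Hn0) as Ht.
    pose proof (low_value_mass A beta B g n (HM n) (Hrow n) Hg Hbeta d eps (r n) Hd Hn0) as Hl.
    set (tail := lsum _ _) in Ht. set (low := lsum _ _) in Hl.
    (* As [b x] is admissible in the supremum, a deviation can only be downward; so a bad [x] has a
       large residual or a low value. *)
    assert (Htot : prob_abs_gt A beta B n (fun x => / INR n * (f_n A beta B n (b_vec A beta B n x)
                           - I_n n (b_vec A beta B n x) - r n)) eps
                   <= (tail + low) / Defs.Z A beta B n).
    { unfold prob_abs_gt; apply Rmult_le_compat_r; [left; now apply Rinv_0_lt_compat|].
      unfold tail, low; rewrite <- lsum_plus; apply lsum_le; intros x _.
      assert (Hw : 0 < weight A beta B n x) by apply exp_pos.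
      set (v := f_n A beta B n (b_vec A beta B n x) - I_n n (b_vec A beta B n x)).
      assert (Hv : v <= r n).
      { apply (proj1 (Hr n)); exists (b_vec A beta B n x); split; [|easy].
        intros i _; pose proof (b_bounds A beta B n x i); lra. }
      destruct (Rlt_dec eps _) as [Hbig|];
        (destruct (Rlt_dec (_ * _) _), (Rle_dec _ _) as [Hle|]; try destruct (Rlt_dec v _));
        try lra.
      exfalso; apply (Rmult_lt_compat_l (INR n)) in Hbig; [|easy].
      rewrite Rabs_mult, Rabs_pos_eq in Hbig by (left; now apply Rinv_0_lt_compat).
      rewrite <- Rmult_assoc, Rinv_r, Rmult_1_l, Rabs_left1 in Hbig by lra.
      lra. }
    eapply Rle_lt_trans; [exact Htot|].
    assert (H1 : tail <= eta / 2 * Defs.Z A beta B n).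
    { eapply Rle_trans; [exact Ht|]; apply Rmult_le_compat_r; [lra|].
      fold C2; apply (Rmult_lt_compat_l (C2 / d ^ 2)) in HN1;
        [|apply Rdiv_lt_0_compat; lra].
      replace (C2 / d ^ 2 * (eta / 2 * d ^ 2 / C2)) with (eta / 2) in HN1 by (field; lra); lra. }
    assert (H2 : low < eta / 2 * Defs.Z A beta B n).
    { eapply Rle_lt_trans; [exact Hl|]; rewrite Ed; fold C.
      (* [ln Z] is an upper bound of [FI_values], hence at least its least upper bound. *)
      assert (Hrz : exp (r n) <= Defs.Z A beta B n).
      { rewrite <- (exp_ln (Defs.Z A beta B n)) by easy; apply exp_le_mono.
        apply (proj2 (Hr n)); intros v [y [Hy ->]].
        apply Rnot_lt_le; intros Hlt; apply exp_increasing in Hlt; rewrite exp_ln in Hlt by easy.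
        pose proof (Z_lower_bound A beta B n (HM n) (Hdiag n) y Hy); lra. }
      eapply Rlt_le_trans; [|apply Rmult_le_compat_l; [lra|exact Hrz]].
      rewrite <- exp_plus.
      replace (C * (/ d ^ 2 * frob (A n) n + 1) + (r n - INR n * eps + eps / 2 * INR n))
        with (- (INR n * eps / 2 - C * (/ d ^ 2 * frob (A n) n + 1)) + r n) by (field; lra).
      rewrite exp_plus; apply Rmult_lt_compat_r; [apply exp_pos|].
      set (t := INR n * eps / 2 - _).
      assert (Hf : C * (/ d ^ 2 * frob (A n) n) <= INR n * eps / 4).
      { apply (Rmult_lt_compat_l (INR n * (C / d ^ 2))) in HN2;
          [|apply Rmult_lt_0_compat; [easy|apply Rdiv_lt_0_compat; lra]].
        replace (INR n * (C / d ^ 2) * (eps / 4 * d ^ 2 / C)) with (INR n * eps / 4) in HN2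
          by (field; lra).
        replace (INR n * (C / d ^ 2) * (/ INR n * frob (A n) n))
          with (C * (/ d ^ 2 * frob (A n) n)) in HN2 by (field; lra).
        lra. }
      assert (Hbign : C + 2 / eta < INR n * eps / 4).
      { assert (INR N3 <= INR n) by (apply le_INR; lia).
        assert (Hlt : (C + 2 / eta) * (4 / eps) < INR n) by lra.
        apply (Rmult_lt_compat_r (eps / 4)) in Hlt; [|lra].
        replace ((C + 2 / eta) * (4 / eps) * (eps / 4)) with (C + 2 / eta) in Hlt
          by (field; lra).
        lra. }
      (* Then [exp t >= 1 + t] gives [exp (- t) < eta / 2]. *)
      assert (Htt : 2 / eta < t) by (unfold t; lra).
      rewrite exp_Ropp.
      assert (0 < 2 / eta) by (apply Rdiv_lt_0_compat; lra).
      replace (eta / 2) with (/ (2 / eta)) by (field; lra).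
      apply Rinv_lt_contravar; [apply Rmult_lt_0_compat; [easy|apply exp_pos]|].
      pose proof (exp_ineq1_le t); lra. }
    apply Rmult_lt_reg_r with (Defs.Z A beta B n); [easy|].
    unfold Rdiv; rewrite Rmult_assoc, Rinv_l by lra; lra.
  - set (d := eps / beta).
    assert (Hd : 0 < d) by now apply Rdiv_lt_0_compat.
    assert (Hd2 : 0 < d ^ 2) by now apply pow_lt.
    destruct (Hmf' (eta * d ^ 2 / C2)) as [N1 HN1]; [apply Rdiv_lt_0_compat; nra|].
    exists (S N1); intros n Hn.
    assert (Hn0 : (0 < n)%nat) by lia; assert (Hn1 := lt_0_INR n Hn0).
    specialize (HN1 n ltac:(lia)).
    assert (HZ : 0 < Defs.Z A beta B n) by (apply Z_pos; auto).
    unfold R_dist; rewrite Rminus_0_r, Rabs_pos_eq by apply Hpr0.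
    pose proof (residual_tail A beta B g n (HM n) (Hdiag n) (Hrow n) Hbeta d Hd Hn0) as Ht.
    fold C2 in Ht; set (tail := lsum _ _) in Ht.
    apply Rle_lt_trans with (tail / Defs.Z A beta B n).
    + unfold prob_abs_gt; apply Rmult_le_compat_r; [left; now apply Rinv_0_lt_compat|].
      apply lsum_le; intros x _.
      assert (Hw : 0 < weight A beta B n x) by apply exp_pos.
      destruct (Rlt_dec eps _) as [Hbig|]; destruct (Rlt_dec _ _) as [|Hsmall]; try lra.
      exfalso; apply Rnot_lt_le in Hsmall.
      assert (Hsq : 0 < sqrt (INR n)) by now apply sqrt_lt_R0.
      enough (grad_norm A beta B n (b_vec A beta B n x) <= eps * sqrt (INR n)).
      { rewrite Rabs_pos_eq in Hbig.
        - apply (Rmult_lt_compat_l (sqrt (INR n))) in Hbig; [|easy].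
          rewrite <- Rmult_assoc, Rinv_r in Hbig by lra; lra.
        - apply Rmult_le_pos; [left; now apply Rinv_0_lt_compat|apply sqrt_pos]. }
      rewrite <- (sqrt_pow2 eps) by lra; rewrite <- sqrt_mult by (try apply pow2_ge_0; lra).
      apply sqrt_le_1_alt.
      (* [artanh] undoes [tanh], so the field [B] cancels and each component is [- beta] times that
         of the matrix applied to the residual. *)
      apply Rle_trans with (beta ^ 2 * normsq n (mv (A n) n (residual A beta B n x))).
      * right; unfold normsq, inner; rewrite <- rsum_scal; apply rsum_ext; intros i _.
        unfold b_vec at 2; rewrite artanh_tanh.
        rewrite (mv_ext (A n) n _ (fun j => 1 * x j + -1 * b_vec A beta B n x j))
          by (intros; unfold residual; ring).
        rewrite mv_lin; change (m_i A n) with (mv (A n) n); ring.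
      * apply (Rmult_le_compat_l (beta ^ 2)) in Hsmall; [|apply pow2_ge_0].
        replace (beta ^ 2 * (d ^ 2 * INR n)) with (eps ^ 2 * INR n) in Hsmall
          by (unfold d; field; lra).
        easy.
    + apply Rmult_lt_reg_r with (Defs.Z A beta B n); [easy|].
      unfold Rdiv at 1; rewrite Rmult_assoc, Rinv_l by lra; rewrite Rmult_1_r.
      eapply Rle_lt_trans; [exact Ht|]; apply Rmult_lt_compat_r; [easy|].
      apply (Rmult_lt_compat_l (C2 / d ^ 2)) in HN1; [|apply Rdiv_lt_0_compat; lra].
      replace (C2 / d ^ 2 * (eta * d ^ 2 / C2)) with eta in HN1 by (field; lra); lra.
Qed.
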